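(* Let $G$ and $H$ be $L^1$-measure equivalent compactly generated locally compact Polish (unimodular) groups. Then $V_G(n)\asymp V_H(n)$.
   Context: For increasing functions $f,g:\mathbb R_+\to\mathbb R_+$, $f\preceq g$ means that there is $C\ge1$ with $f(t)\le Cg(Ct)+C$ for all $t$, and $f\asymp g$ means $f\preceq g\preceq f$. The volume growth $V_G$ of a compactly generated locally compact group $G$ is the $\asymp$-class of the function associating to $r\in\mathbb R_+$ the Haar measure of the ball of radius $r$ for the word metric of a compact generating set (independent of the generating set). Measure equivalence. Let $G,H$ be unimodular locally compact second countable compactly generated groups with Haar measures $\lambda_G,\lambda_H$ and word lengths $|\cdot|_G,|\cdot|_H$ for compact generating sets. A measure equivalence coupling is a measure space $(\Omega,\mu)$, finite measure spaces $(X_G,\mu_G),(X_H,\mu_H)$ and measure space isomorphisms $\iota:G\times X_G\to\Omega$, $j:H\times X_H\to\Omega$ (product measures) such that the actions $g\cdot\iota(g',x)=\iota(gg',x)$ and $h\cdot j(h',x)=j(hh',x)$ commute. Its cocycles $\alpha:G\times X_H\to H$, $\beta:H\times X_G\to G$ and induced actions $T$ of $G$ on $X_H$, $S$ of $H$ on $X_G$ are defined a.e. by $g\cdot j(h,x)=j(h\alpha(g,x)^{-1},T^gx)$ and $h\cdot\iota(g,y)=\iota(g\beta(h,y)^{-1},S^hy)$. $G,H$ are $L^1$-measure equivalent if there is a coupling with $\int_{X_H}|\alpha(g,x)|_H\,d\mu_H<\infty$ for all $g\in G$ and $\int_{X_G}|\beta(h,y)|_G\,d\mu_G<\infty$ for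 all $h\in H$. *)

(* Defs.v *)
From HB Require Import structures.
From mathcomp Require Import all_boot all_order all_algebra.
From mathcomp Require Import all_classical all_reals all_analysis.

Set Implicit Arguments.
Unset Strict Implicit.
Unset Printing Implicit Defensive.

Import Order.TTheory GRing.Theory Num.Theory.

Local Open Scope classical_set_scope.
Local Open Scope ring_scope.

HB.mixin Record Group_isTopologicalGroup G & Group G & Topological G := {
  mulg_continuous : continuous (fun x : G * G => (x.1 * x.2)%g) ;
  invg_continuous : continuous (fun x : G => (x^-1)%g)
}.

(* The point is irrelevant: the library's measurable types must be pointed,
   hence so must be the carrier of a Borel sigma-algebra. *)
#[short(type="topologicalGroupType")]
HB.structure Definition TopologicalGroup :=
  {G of Group G & PointedTopological G & Group_isTopologicalGroup G}.

Definition borel (T : ptopologicalType) := g_sigma_algebraType (@open T).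

Definition compatible_complete_metric (R : realType) (T : topologicalType)
    (d : T -> T -> R) : Prop :=
  [/\ forall x y, d x y = 0 <-> x = y,
      forall x y, d x y = d y x,
      forall x y z, d x z <= d x y + d y z,
      forall (x : T) (A : set T),
        nbhs x A <-> exists2 e : R, 0 < e & [set y | d x y < e] `<=` A &
      forall u : nat -> T,
        (forall e : R, 0 < e -> exists N, forall m n,
          (N <= m)%N -> (N <= n)%N -> d (u m) (u n) < e) ->
        exists l : T, u n @[n --> \oo] --> l].

Definition polish (R : realType) (T : topologicalType) : Prop :=
  (exists2 D : set T, countable D & dense D) /\
  (exists d : T -> T -> R, compatible_complete_metric d).

(* On a locally compact Polish group, a Borel measure that is finite on
   compact sets is automatically regular. *)
Definition haar_measure (R : realType) (G : topologicalGroupType)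
    (lambda : {measure set (borel G) -> \bar R}) : Prop :=
  [/\ forall K : set G, compact K -> (lambda K < +oo)%E,
      lambda setT != 0%E &
      forall (g : G) (A : set (borel G)), measurable A ->
        lambda [set (g * x)%g | x in A] = lambda A].

Definition unimodular (R : realType) (G : topologicalGroupType) : Prop :=
  forall lambda : {measure set (borel G) -> \bar R}, haar_measure lambda ->
  forall (g : G) (A : set (borel G)), measurable A ->
    lambda [set (x * g)%g | x in A] = lambda A.

Section word_metric.
Context (R : realType) (G : topologicalGroupType).
Implicit Types (S : set G) (w : seq G) (g : G).

Definition word_for S g w : Prop :=
  (forall s, s \in w -> S s \/ S (s^-1)%g) /\ g = (\big[*%g/1]_(s <- w) s)%g.

Definition compact_generating_set S : Prop :=
  compact S /\ forall g, exists w, word_for S g w.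

(* Extended-real-valued, so as to be [+oo] outside the subgroup generated
   by [S]. *)
Definition word_length S g : \bar R :=
  ereal_inf [set ((size w)%:R%:E : \bar R) | w in word_for S g].

Definition word_ball S (r : R) : set G := [set g | (word_length S g <= r%:E)%E].

(* [fine] loses nothing: balls are compact, hence of finite Haar measure. *)
Definition volume_growth (lambda : {measure set (borel G) -> \bar R}) S
    (r : R) : R := fine (lambda (word_ball S r)).

End word_metric.

Definition growth_le (R : realType) (f g : R -> R) : Prop :=
  exists2 C, 1 <= C & forall t, 0 <= t -> f t <= C * g (C * t) + C.

Definition growth_equiv (R : realType) (f g : R -> R) : Prop :=
  growth_le f g /\ growth_le g f.

(* Isomorphism up to null sets: inverting [f] almost everywhere by a measurable
   [f'] amounts to restricting it to a bimeasurable bijection between conull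
   measurable subsets. *)
Definition measure_space_iso (R : realType) d1 d2 (T1 : measurableType d1)
    (T2 : measurableType d2) (m1 : set T1 -> \bar R) (m2 : set T2 -> \bar R)
    (f : T1 -> T2) (f' : T2 -> T1) : Prop :=
  [/\ measurable_fun setT f, measurable_fun setT f',
      {ae m1, forall x, f' (f x) = x},
      {ae m2, forall y, f (f' y) = y} &
      forall B, measurable B -> m1 (f @^-1` B) = m2 B].

(* The action on [Omega] characterized by g . f (g', x) = f (g g', x) almost
   everywhere, for [f : G * X -> Omega] with almost inverse [f']. *)
Definition translation (G : topologicalGroupType) (X Omega : Type)
    (f : G * X -> Omega) (f' : Omega -> G * X) (g : G) (w : Omega) : Omega :=
  f ((g * (f' w).1)%g, (f' w).2).

(* [Omega] is required to be non-null, as is implicit in the notion: otherwise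
   any two groups would be coupled. *)
Record me_coupling (R : realType) (G H : topologicalGroupType)
    (lambdaG : {measure set (borel G) -> \bar R})
    (lambdaH : {measure set (borel H) -> \bar R}) := MECoupling {
  cpl_dO : measure_display ;
  cpl_dG : measure_display ;
  cpl_dH : measure_display ;
  cpl_Omega : measurableType cpl_dO ;
  cpl_XG : measurableType cpl_dG ;
  cpl_XH : measurableType cpl_dH ;
  cpl_mu : {measure set cpl_Omega -> \bar R} ;
  cpl_muG : {finite_measure set cpl_XG -> \bar R} ;
  cpl_muH : {finite_measure set cpl_XH -> \bar R} ;
  cpl_iota : borel G * cpl_XG -> cpl_Omega ;
  cpl_iota' : cpl_Omega -> borel G * cpl_XG ;
  cpl_j : borel H * cpl_XH -> cpl_Omega ;
  cpl_j' : cpl_Omega -> borel H * cpl_XH ;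
  cpl_iota_iso :
    measure_space_iso (lambdaG \x cpl_muG)%E cpl_mu cpl_iota cpl_iota' ;
  cpl_j_iso :
    measure_space_iso (lambdaH \x cpl_muH)%E cpl_mu cpl_j cpl_j' ;
  cpl_commute : forall (g : G) (h : H),
    let ag := @translation G cpl_XG cpl_Omega cpl_iota cpl_iota' g in
    let ah := @translation H cpl_XH cpl_Omega cpl_j cpl_j' h in
    {ae cpl_mu, forall w, ag (ah w) = ah (ag w)} ;
  cpl_mu_neq0 : cpl_mu setT != 0%E
}.

Arguments cpl_iota {R G H lambdaG lambdaH} m _.
Arguments cpl_iota' {R G H lambdaG lambdaH} m _.
Arguments cpl_j {R G H lambdaG lambdaH} m _.
Arguments cpl_j' {R G H lambdaG lambdaH} m _.

Section coupling_actions.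
Context (R : realType) (G H : topologicalGroupType).
Context (lambdaG : {measure set (borel G) -> \bar R}).
Context (lambdaH : {measure set (borel H) -> \bar R}).
Context (c : me_coupling lambdaG lambdaH).

Definition cpl_actG : G -> cpl_Omega c -> cpl_Omega c :=
  @translation G (cpl_XG c) (cpl_Omega c) (cpl_iota c) (cpl_iota' c).

Definition cpl_actH : H -> cpl_Omega c -> cpl_Omega c :=
  @translation H (cpl_XH c) (cpl_Omega c) (cpl_j c) (cpl_j' c).

End coupling_actions.

Arguments cpl_actG {R G H lambdaG lambdaH} c _ _.
Arguments cpl_actH {R G H lambdaG lambdaH} c _ _.

(* [a] is the action of [G] on [Omega], and [j : H * X -> Omega] trivializes the
   action of [H]; [alpha] is the cocycle and [T] the induced action. As [j] is
   injective only up to a null set, the equation determines [alpha g] and [T g]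
   almost everywhere only for [T g] nonsingular (here measure-preserving, as the
   induced action is when [H] is unimodular): otherwise [T g] could take its
   values in a null set on which [j] is arbitrary. *)
Definition induced_cocycle (R : realType) (G H : topologicalGroupType)
    d (X : measurableType d) (Omega : Type)
    (lambdaH : {measure set (borel H) -> \bar R})
    (muX : {finite_measure set X -> \bar R})
    (a : G -> Omega -> Omega) (j : borel H * X -> Omega)
    (alpha : G -> X -> borel H) (T : G -> X -> X) : Prop :=
  forall g : G,
  [/\ measurable_fun setT (alpha g), measurable_fun setT (T g),
      forall B, measurable B -> muX (T g @^-1` B) = muX B &
      {ae (lambdaH \x muX)%E, forall p : borel H * X,
        a g (j p) =
        j (((p.1 : H) * (alpha g p.2 : H)^-1)%g : borel H, T g p.2)}].

Definition L1_coupling (R : realType) (G H : topologicalGroupType)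
    (lambdaG : {measure set (borel G) -> \bar R})
    (lambdaH : {measure set (borel H) -> \bar R})
    (SG : set G) (SH : set H) (c : me_coupling lambdaG lambdaH) : Prop :=
  exists (alpha : G -> cpl_XH c -> borel H) (T : G -> cpl_XH c -> cpl_XH c)
         (beta : H -> cpl_XG c -> borel G) (S : H -> cpl_XG c -> cpl_XG c),
  [/\ induced_cocycle lambdaH (cpl_muH c) (cpl_actG c) (cpl_j c) alpha T,
      induced_cocycle lambdaG (cpl_muG c) (cpl_actH c) (cpl_iota c) beta S,
      forall g, (\int[cpl_muH c]_x word_length R SH (alpha g x) < +oo)%E &
      forall h, (\int[cpl_muG c]_y word_length R SG (beta h y) < +oo)%E].

Definition L1_measure_equivalent (R : realType) (G H : topologicalGroupType)
    : Prop :=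
  exists (lambdaG : {measure set (borel G) -> \bar R})
         (lambdaH : {measure set (borel H) -> \bar R})
         (SG : set G) (SH : set H),
  [/\ haar_measure lambdaG, haar_measure lambdaH,
      compact_generating_set SG, compact_generating_set SH &
      exists c : me_coupling lambdaG lambdaH, L1_coupling SG SH c].

(* Main.v *)
Require Import Defs.
From HB Require Import structures.
From mathcomp Require Import all_boot all_order all_algebra.
From mathcomp Require Import all_classical all_reals all_analysis.
From mathcomp Require Import measurable_realfun ring lra.

(** Let [Omega] be an integrable coupling.  Up to null sets it is both
    [G * X_G] and [H * X_H], so a point [w] of [Omega] has a [G]-coordinate and
    an [H]-coordinate.  The element [g] of [G] multiplies the former by [g] on
    the left and the latter by the inverse of [alpha g x] on the right, where
    [x] is the [X_H]-coordinate of [w].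

    Integrability says that [H]-coordinates are displaced linearly on average.
    Indeed [g |-> \int |alpha g x| dx] is finite, subadditive (cocycle identity:
    [displacementM]) and Borel ([measurable_displacement]); such a function is
    bounded on the unit ball, hence at most affine in the word length
    ([subadditive_bounded]).

    Fix [r] such that the set [A] of points whose two coordinates both lie in
    balls of radius [r] is non-null.  For [g] in the ball [B_G(t)], Markov's
    inequality ([escape_le]) shows that at least half of [A] is moved by [g]
    to points with [H]-coordinate in a ball [B_H(s)], where [s] is affine in
    [t].  Now measure the set of pairs [(g, w)] with [w] in [A] and [g w] in the
    set [B] of points with [H]-coordinate in [B_H(s)].  It has measure at least
    [|B_G(t)| * mu(A) / 2].  On the other hand, fix [w = (k, y)] in
    [G * X_G]: as [g w = (g k, y)], right invariance of the Haar measure says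
    that the [g] with [g w] in [B] have the measure of the slice of [B] above
    [y].  Since [k] stays in [B_G(r)], the total is at most
    [|B_G(r)| * mu(B) = |B_G(r)| * |B_H(s)| * mu_H(X_H)] ([ball_mul_le]).
    Hence the growth of [G] is dominated by that of [H] ([coupling_growth_le]),
    and exchanging the roles of [G] and [H] gives the other inequality.

    The coupling comes with its own Haar measures and generating sets.
    [volume_growth_change] passes to the given ones: the same double counting
    compares two Haar measures on balls, and word lengths are themselves
    subadditive functions. *)

Set Implicit Arguments.
Unset Strict Implicit.
Unset Printing Implicit Defensive.

Import Order.TTheory GRing.Theory Num.Theory.
Import numFieldNormedType.Exports.

Local Open Scope classical_set_scope.
Local Open Scope ring_scope.

(** * Borel structure of Polish groups *)

Section polish.
Context (R : realType) (T : topologicalType).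

Lemma polish_hausdorff : polish R T -> hausdorff_space T.
Proof.
move=> [_ [d [d0 dC dT dn _]]] x y xy.
apply/d0/eqP; apply: contrapT => /negP dxy.
have dge0 : 0 <= d x y.
  by have := dT x y x; rewrite (d0 x x).2// (dC y x) => ?; lra.
have dgt0 : 0 < d x y by rewrite lt_neqAle dge0 eq_sym andbT; exact: dxy.
have [||z [/= xz yz]] := xy [set z | d x z < d x y / 2] [set z | d y z < d x y / 2].
- by apply/dn; exists (d x y / 2) => //; rewrite divr_gt0.
- by apply/dn; exists (d x y / 2) => //; rewrite divr_gt0.
have := le_lt_trans (dT x z y) (ltrD xz _); rewrite (dC z y) => /(_ _ yz).
by rewrite -splitr ltxx.
Qed.

Lemma polish_second_countable : polish R T -> second_countable (T := T).
Proof.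
move=> [[D cD dD] [d [d0 dC dT dn _]]].
pose B (p : T * nat) := [set y | d p.1 y < p.2.+1%:R^-1].
have oB p : open (B p).
  rewrite openE => y /= By; apply/dn.
  exists (p.2.+1%:R^-1 - d p.1 y); first by rewrite subr_gt0.
  move=> z /=; rewrite ltrBrDl; apply: le_lt_trans; exact: dT.
exists (B @` (D `*` setT)).
  apply: (sub_countable (card_image_le _ _)).
  by apply: countableX.
split=> [_ [p _ <-]//|x A /dn[e e0 eA]].
have [n ne] : exists n : nat, n.+1%:R^-1 < e / 2.
  have e20 : 0 < e / 2 by rewrite divr_gt0.
  have [N _ /(_ N (leqnn _)) NE] := near_infty_natSinv_lt (PosNum e20).
  by exists N.
have [q [Dq /= Bq]] : (D `&` B (x, n)) !=set0.
  rewrite setIC; apply: dD => //; exists x => /=.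
  by rewrite /B/= (d0 x x).2// invr_gt0.
exists (B (q, n)); first by split; [exists (q, n)|rewrite /B/= dC].
move=> z /= qz; apply: eA => /=; apply: (le_lt_trans (dT x q z)).
by rewrite [e]splitr ltrD//; apply: lt_trans ne.
Qed.

End polish.

Lemma measurable_preimageT d1 d2 (T1 : measurableType d1)
    (T2 : measurableType d2) (f : T1 -> T2) (A : set T2) :
  measurable_fun setT f -> measurable A -> measurable (f @^-1` A).
Proof. by move=> mf mA; rewrite -[X in measurable X]setTI; exact: mf. Qed.

(** Second countability is what makes the Borel sets of a product belong to the
    product sigma-algebra: an open set is a countable union of open boxes. *)
Lemma open_measurable_prod (T1 T2 : ptopologicalType) (U : set (T1 * T2)) :
  second_countable (T := T1) -> second_countable (T := T2) -> open U ->
  measurable (U : set (borel T1 * borel T2)).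
Proof.
move=> [B1 cB1 [oB1 bB1]] [B2 cB2 [oB2 bB2]] oU.
pose C := [set c | [/\ B1 c.1, B2 c.2 & c.1 `*` c.2 `<=` U]].
have cC : countable C.
  apply: (@sub_countable _ _ _ (B1 `*` B2)); last exact: countableX.
  by apply: subset_card_le => c [].
have -> : U = \bigcup_(c in C) (c.1 `*` c.2).
  apply/seteqP; split; last by move=> p [c [_ _ cU]]; exact: cU.
  move=> [x y] Uxy.
  have /= := oU; rewrite openE => /(_ _ Uxy) [[V W] /= [nV nW] VWU].
  have [b1 [B1b b1x] b1V] := bB1 x V nV.
  have [b2 [B2b b2y] b2W] := bB2 y W nW.
  exists (b1, b2) => //; split => // -[u v] [/= ub vb].
  by apply: VWU; split; [exact: b1V|exact: b2W].
rewrite bigcup_set_type; apply: countable_bigcupT_measurable.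
  by rewrite (eq_countable (card_setT _)).
move=> i; have [B1i B2i _] := set_valP i.
by apply: measurableX; apply: sub_sigma_algebra; [exact: oB1|exact: oB2].
Qed.

Lemma continuous_measurable (T1 T2 : ptopologicalType) (f : T1 -> T2) :
  continuous f -> measurable_fun setT (f : borel T1 -> borel T2).
Proof.
move=> cf.
apply: (@measurability _ _ (borel T1) (borel T2) setT f (@open T2)) => //.
move=> _ [U oU <-]; rewrite setTI; apply: sub_sigma_algebra.
by move/continuousP : cf; apply.
Qed.

Lemma continuous2_measurable (T1 T2 T3 : ptopologicalType) (f : T1 * T2 -> T3) :
  second_countable (T := T1) -> second_countable (T := T2) -> continuous f ->
  measurable_fun setT (f : borel T1 * borel T2 -> borel T3).
Proof.
move=> c1 c2 cf.
apply: (@measurability _ _ (borel T1 * borel T2)%type (borel T3) setT f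
  (@open T3)) => //.
move=> _ [U oU <-]; rewrite setTI; apply: open_measurable_prod => //.
by move/continuousP : cf; apply.
Qed.

Section group_measurability.
Context (R : realType) (G : topologicalGroupType) (polG : polish R G).

Lemma measurable_mulg d (T : measurableType d) (f g : T -> borel G) :
  measurable_fun setT f -> measurable_fun setT g ->
  measurable_fun setT (fun x => ((f x : G) * (g x : G))%g : borel G).
Proof.
move=> mf mg.
have cG := polish_second_countable polG.
have mM : measurable_fun setT
    ((fun p => (p.1 * p.2)%g : G) : borel G * borel G -> borel G).
  by apply: continuous2_measurable => //; exact: mulg_continuous.
exact: (measurableT_comp mM (measurable_fun_pair mf mg)).
Qed.

Lemma measurable_mull (g : G) :
  measurable_fun setT ((fun x : G => (g * x)%g) : borel G -> borel G).
Proof.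
exact: (measurable_mulg (@measurable_cst _ _ _ (borel G) setT g)
  (@measurable_id _ (borel G) setT)).
Qed.

Lemma measurable_mulr (g : G) :
  measurable_fun setT ((fun x : G => (x * g)%g) : borel G -> borel G).
Proof.
exact: (measurable_mulg (@measurable_id _ (borel G) setT)
  (@measurable_cst _ _ _ (borel G) setT g)).
Qed.

Lemma measurable_invg d (T : measurableType d) (f : T -> borel G) :
  measurable_fun setT f ->
  measurable_fun setT (fun x => ((f x : G)^-1)%g : borel G).
Proof.
have mV : measurable_fun setT ((fun x : G => x^-1%g) : borel G -> borel G).
  by apply: continuous_measurable; exact: invg_continuous.
exact: (measurableT_comp mV).
Qed.

Lemma compact_borel (K : set G) : compact K -> measurable (K : set (borel G)).
Proof.
move=> cK; rewrite -(setCK K); apply: measurableC; apply: sub_sigma_algebra.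
apply: closed_openC; apply: (compact_closed (polish_hausdorff polG)).
exact: cK.
Qed.

End group_measurability.

(** * Word length *)

Section word_length_theory.
Context (R : realType) (G : topologicalGroupType) (S : set G).
Implicit Types (g h : G) (w : seq G) (r : R).

Lemma word_for_cat g h v w :
  word_for S g v -> word_for S h w -> word_for S (g * h)%g (v ++ w).
Proof.
move=> [Sv ->] [Sw ->]; split; last by rewrite big_cat.
by move=> s; rewrite mem_cat => /orP[/Sv|/Sw].
Qed.

Lemma word_forV g w : word_for S g w -> exists2 v, word_for S g^-1%g v & size v = size w.
Proof.
move=> [Sw ->]; exists (rev (map (fun s => s^-1%g) w)); last by rewrite size_rev size_map.
split.
  by move=> t; rewrite mem_rev => /mapP[u /Sw[] Su ->]; [right; rewrite invgK|left].
by rewrite -map_rev big_map prodgV revK.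
Qed.

(** The infimum defining the word length is attained, its values being natural
    numbers. *)
Lemma word_ballP r g :
  word_ball S r g <-> exists2 w, word_for S g w & (size w)%:R <= r.
Proof.
split=> [gr|[w wg wr]]; last first.
  apply: (@le_trans _ _ (size w)%:R%:E); last by rewrite lee_fin.
  by apply: ereal_inf_lbound; exists w.
pose P n := `[< exists2 w, word_for S g w & size w = n >].
have [exP|noP] := pselect (exists n, P n).
  have [n /asboolP[w wg wn] nmin] := ex_minnP exP.
  exists w => //; rewrite -lee_fin; apply: le_trans gr.
  apply: le_ereal_inf_tmp => _ [v vg <-]; rewrite lee_fin ler_nat wn.
  by apply: nmin; apply/asboolP; exists v.
suff E : word_length R S g = +oo%E by move: gr; rewrite /word_ball/= E.
rewrite /word_length (_ : image _ _ = set0) ?ereal_inf0//.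
apply/seteqP; split=> [t [v vg _]|]//.
by apply: noP; exists (size v); apply/asboolP; exists v.
Qed.

Lemma word_length_ge0 g : (0 <= word_length R S g)%E.
Proof. by apply: le_ereal_inf_tmp => _ [v _ <-]; rewrite lee_fin. Qed.

Lemma word_ballM r s g h : word_ball S r g -> word_ball S s h ->
  word_ball S (r + s) (g * h)%g.
Proof.
move=> /word_ballP[v vg vr] /word_ballP[w wh ws].
apply/word_ballP; exists (v ++ w); first exact: word_for_cat.
by rewrite size_cat natrD lerD.
Qed.

Lemma word_ballV r g : word_ball S r g -> word_ball S r g^-1%g.
Proof.
move=> /word_ballP[w /word_forV[v vg vw] wr]; apply/word_ballP.
by exists v => //; rewrite vw.
Qed.

Lemma le_word_ball r s : r <= s -> word_ball S r `<=` word_ball S s.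
Proof. by move=> rs g; rewrite /word_ball/= => /le_trans; apply; rewrite lee_fin. Qed.

Lemma word_ball1 r : 0 <= r -> word_ball S r 1%g.
Proof. by move=> r0; apply/word_ballP; exists [::] => //; split; rewrite ?big_nil. Qed.

Lemma word_ball_gen s : S s -> word_ball S (1 : R) s.
Proof.
move=> Ss; apply/word_ballP; exists [:: s] => //; split; rewrite ?big_seq1//.
by move=> t; rewrite inE => /eqP ->; left.
Qed.

Hypothesis genS : compact_generating_set S.

Lemma word_length_lty g : (word_length R S g < +oo)%E.
Proof.
have [_ /(_ g)[w wg]] := genS.
apply: (@le_lt_trans _ _ (size w)%:R%:E); last exact: ltry.
by apply: ereal_inf_lbound; exists w.
Qed.

Lemma word_length_fin_num g : word_length R S g \is a fin_num.
Proof. by rewrite ge0_fin_numE ?word_length_ge0// word_length_lty. Qed.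

Lemma word_lengthM g h :
  (word_length R S (g * h)%g <= word_length R S g + word_length R S h)%E.
Proof.
have fg := word_length_fin_num g; have fh := word_length_fin_num h.
rewrite -(fineK fg) -(fineK fh) -EFinD; apply: word_ballM.
  by rewrite /word_ball/= fineK.
by rewrite /word_ball/= fineK.
Qed.

Lemma word_ball_cover g : exists n : nat, word_ball S (n%:R : R) g.
Proof.
have [_ /(_ g)[w wg]] := genS; exists (size w); apply/word_ballP.
by exists w.
Qed.

(** Compactness goes by induction on the length, a ball of radius [n + 1] being
    covered by the ball of radius [n] and the product of the symmetrized
    generators with it. *)
Let nball (n : nat) : set G := [set g | exists2 w, word_for S g w & (size w <= n)%N].

Let nball_compact n : compact (nball n).
Proof.
elim: n => [|n IH].
  rewrite (_ : nball _ = [set 1%g]); first exact: compact_set1.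
  apply/seteqP; split=> [g [[|//] [_ ->] _]|_ ->]; first by rewrite big_nil.
  by exists [::] => //; split; rewrite ?big_nil.
have cS : compact (S `|` (fun x => x^-1%g) @` S).
  apply: compactU; first exact: genS.1.
  apply: continuous_compact; last exact: genS.1.
  by apply: continuous_subspaceT; exact: invg_continuous.
rewrite (_ : nball _ = nball n `|`
    (fun p : G * G => (p.1 * p.2)%g) @` ((S `|` (fun x => x^-1%g) @` S) `*` nball n)).
  apply: compactU => //; apply: continuous_compact.
    by apply: continuous_subspaceT; exact: mulg_continuous.
  exact: compact_setX.
apply/seteqP; split=> [g [[|s w] [Sw gw] /= wn]|g [[w wg wn]|]].
- by left; exists [::].
- right; exists (s, (\big[*%g/1]_(s <- w) s)%g); last by rewrite /= gw big_cons.
  split => /=; last first.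
    by exists w => //; split => // t tw; apply: Sw; rewrite inE tw orbT.
  have [Ss|Ss] := Sw s (mem_head _ _); first by left.
  by right; exists s^-1%g => //; rewrite invgK.
- by exists w => //; exact: leq_trans wn _.
- move=> [[s t]/= [sS [w [Sw tw] wn]] <-]; exists (s :: w) => //.
  split; last by rewrite big_cons tw.
  move=> u; rewrite inE => /orP[/eqP ->|/Sw//].
  by case: sS => [|[v Sv <-]]; [left|right; rewrite invgK].
Qed.

Lemma word_ball_compact r : compact (word_ball S r).
Proof.
have [r0|r0] := ltP r 0.
  rewrite (_ : word_ball S r = set0); first exact: compact0.
  apply/seteqP; split=> // g /word_ballP[w _ /le_lt_trans/(_ r0)].
  by rewrite ltrn0.
rewrite (_ : word_ball S r = nball (Num.truncn r)); first exact: nball_compact.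
apply/seteqP; split=> g.
  by move=> /word_ballP[w wg wr]; exists w => //; rewrite truncn_ge_nat.
move=> [w wg wr]; apply/word_ballP; exists w => //.
by rewrite -truncn_ge_nat.
Qed.

End word_length_theory.

Section word_length_measurability.
Context (R : realType) (G : topologicalGroupType) (polG : polish R G).
Context (S : set G) (genS : compact_generating_set S).

Lemma word_ball_measurable (r : R) :
  measurable (word_ball S r : set (borel G)).
Proof. by apply: (compact_borel polG); exact: word_ball_compact. Qed.

Lemma word_length_measurable d (T : measurableType d) (f : T -> borel G) :
  measurable_fun setT f ->
  measurable_fun setT (fun x => word_length R S (f x)).
Proof.
move=> mf; apply: (measurableT_comp _ mf).
apply: (measurability _ (ErealGenOInfty.measurableE R)) => // _ [_ [x ->] <-].
rewrite setTI (_ : _ @^-1` _ = ~` (word_ball S x)).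
  by apply: measurableC; exact: word_ball_measurable.
apply/seteqP; split => g; rewrite /word_ball/= in_itv/= andbT.
  by rewrite ltNge => /negP.
by move=> /negP; rewrite -ltNge.
Qed.

End word_length_measurability.

(** * Haar measure of balls and subadditive functions *)

Lemma measure_bigcup_gt0 d (T : measurableType d) (R : realType)
    (m : {measure set T -> \bar R}) (F : nat -> set T) :
  (forall n, measurable (F n)) -> m (\bigcup_n F n) != 0%E ->
  exists n, (0 < m (F n))%E.
Proof.
move=> mF /eqP mUF; apply: contrapT => no; apply: mUF.
apply: measure_negligible; first exact: bigcupT_measurable.
apply: negligible_bigcup => n; apply/negligibleP => //.
apply/eqP; rewrite eq_le measure_ge0 andbT leNgt; apply/negP => n0.
by apply: no; exists n.
Qed.

Section haar.
Context (R : realType) (G : topologicalGroupType) (polG : polish R G).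
Context (lam : {measure set (borel G) -> \bar R}) (haarG : haar_measure lam).

Lemma haar_mull (g : G) (A : set (borel G)) : measurable A ->
  lam [set x | A (g * x)%g] = lam A.
Proof.
move=> mA; have [_ _ /(_ g^-1%g A mA) <-] := haarG; congr (lam _).
apply/seteqP; split => x /=.
  by move=> Ax; exists (g * x)%g => //; rewrite mulgA mulVg mul1g.
by move=> [y Ay <-]; rewrite mulgA mulgV mul1g.
Qed.

Lemma haar_mulr : unimodular R G -> forall (g : G) (A : set (borel G)),
  measurable A -> lam [set x | A (x * g)%g] = lam A.
Proof.
move=> uG g A mA; have <- := uG lam haarG g^-1%g A mA; congr (lam _).
apply/seteqP; split => x /=.
  by move=> Ax; exists (x * g)%g => //; rewrite -mulgA mulgV mulg1.
by move=> [y Ay <-]; rewrite -mulgA mulVg mulg1.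
Qed.

Section ball.
Context (S : set G) (genS : compact_generating_set S).

Lemma haar_word_ball_lty (r : R) : (lam (word_ball S r) < +oo)%E.
Proof. by have [h _ _] := haarG; apply: h; exact: word_ball_compact. Qed.

Lemma haar_word_ball_fin_num (r : R) : lam (word_ball S r) \is a fin_num.
Proof. by rewrite ge0_fin_numE// haar_word_ball_lty. Qed.

Lemma word_ball_bigcup : \bigcup_n word_ball S (n%:R : R) = setT.
Proof.
apply/seteqP; split=> // g _; have [n ng] := word_ball_cover R genS g.
by exists n.
Qed.

Lemma haar_sigma_finite : sigma_finite setT lam.
Proof.
exists (fun n => word_ball S (n%:R : R)); first by rewrite word_ball_bigcup.
by move=> n; split; [exact: word_ball_measurable|exact: haar_word_ball_lty].
Qed.

Lemma haar_word_ball_gt0 : exists n : nat, (0 < lam (word_ball S (n%:R : R)))%E.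
Proof.
have [_ lam0 _] := haarG; apply: measure_bigcup_gt0.
  by move=> n; exact: word_ball_measurable.
by rewrite word_ball_bigcup.
Qed.

Lemma le_volume_growth (r s : R) : r <= s ->
  volume_growth lam S r <= volume_growth lam S s.
Proof.
move=> rs; rewrite fine_le ?haar_word_ball_fin_num//.
by apply: le_measure; rewrite ?inE; [exact: word_ball_measurable..|exact: le_word_ball].
Qed.

Lemma volume_growth_ge0 (r : R) : 0 <= volume_growth lam S r.
Proof. exact: fine_ge0. Qed.

Lemma volume_growthE (r : R) :
  lam (word_ball S r) = (volume_growth lam S r)%:E.
Proof. by rewrite fineK// haar_word_ball_fin_num. Qed.

Section subadditive.
Context (L : G -> \bar R).
Hypothesis mL : measurable_fun setT (L : borel G -> \bar R).
Hypothesis L0 : forall g, (0 <= L g)%E.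
Hypothesis Loo : forall g, (L g < +oo)%E.
Hypothesis LM : forall g h, (L (g * h)%g <= L g + L h)%E.

(** On a large ball, which has finite measure, [L] and its composition with
    inversion are bounded by a common [N] off a set [F N] of small measure, the
    smallness being uniform under translation by [s] in the unit ball.  So
    some [g] makes both factors of [s = (s * g) * g^-1] good, and
    [L s <= 2 N]. *)
Let subadditive_bounded_generators :
  exists C : nat, forall s, word_ball S (1 : R) s -> (L s <= C%:R%:E)%E.
Proof.
have [n n0] := haar_word_ball_gt0.
pose K := word_ball S (n%:R : R); pose K' := word_ball S (n.+1%:R : R).
pose E (N : nat) := [set g | (L g <= N%:R%:E)%E /\ (L g^-1%g <= N%:R%:E)%E].
pose F N := K' `\` E N.
have mK : measurable (K : set (borel G)) by exact: word_ball_measurable.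
have mK' : measurable (K' : set (borel G)) by exact: word_ball_measurable.
have mLV : measurable_fun setT ((fun g => L g^-1%g) : borel G -> \bar R).
  by apply: (measurableT_comp mL); apply: measurable_invg; exact: measurable_id.
have mE N : measurable (E N : set (borel G)).
  apply: measurableI; rewrite -[X in measurable X]setTI;
    exact: emeasurable_fun_infty_c.
have mF N : measurable (F N : set (borel G)) by exact: measurableD.
have F0 : lam (F N) @[N --> \oo] --> lam (\bigcap_N F N).
  apply: nonincreasing_cvg_mu => //.
  - apply: (@le_lt_trans _ _ (lam K')); last exact: haar_word_ball_lty.
    by apply: le_measure; rewrite ?inE//; exact: subDsetl.
  - exact: bigcapT_measurable.
  - move=> a b ab; apply/subsetPset => g [K'g nE]; split => // -[La LVa]; apply: nE.
    by split; [apply: le_trans La _|apply: le_trans LVa _]; rewrite lee_fin ler_nat.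
have capF : \bigcap_N F N = set0.
  apply/seteqP; split => // g Fg.
  have fL h : (L h <= (Num.truncn (fine (L h))).+1%:R%:E)%E.
    have fh : L h \is a fin_num by rewrite ge0_fin_numE.
    by rewrite -(fineK fh) lee_fin ltW// truncnS_gt.
  have [_] := Fg (maxn (Num.truncn (fine (L g))).+1
                       (Num.truncn (fine (L g^-1%g))).+1) I.
  apply; split; apply: (le_trans (fL _)); rewrite lee_fin ler_nat.
    exact: leq_maxl.
  exact: leq_maxr.
rewrite capF measure0 in F0.
have K20 : (0 < (fine (lam K) / 2)%:E)%E.
  by rewrite lte_fin divr_gt0// fine_gt0// n0 haar_word_ball_lty.
have [N _ /(_ N (leqnn _)) /= FN] := F0 _ (open_ereal_lt' K20).
exists (N + N)%N => s s1.
have [[g [[Kg [Lg LVg]] [Lsg _]]]|no] :=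
  pselect (exists g, (K g /\ E N g) /\ E N (s * g)%g).
  rewrite -[s](mulgK g); apply: (le_trans (LM _ _)).
  by rewrite natrD EFinD leeD.
have msF : measurable ([set g | F N (s * g)%g] : set (borel G)).
  exact: measurable_preimageT (measurable_mull polG s) (mF N).
(* Otherwise [K] is covered by two sets of measure less than half of its own. *)
exfalso; have : (lam K <= lam (F N `|` [set g | F N (s * g)%g]))%E.
  apply: le_measure; rewrite ?inE//; first exact: measurableU.
  move=> g Kg; apply: contrapT => /not_orP[nF nsF]; apply: no; exists g.
  split; [split => //|]; apply: contrapT => nE.
    by apply: nF; split => //; apply: le_word_ball Kg; rewrite ler_nat.
  apply: nsF; split => //; rewrite /K' -addn1 natrD addrC.
  exact: word_ballM.
apply/negP; rewrite -ltNge; apply: (le_lt_trans (measureU2 _ _ _)) => //.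
rewrite [X in (_ + X)%E](_ : _ = lam (F N)); last exact: haar_mull.
by rewrite -[X in (_ < X)%E](fineK (haar_word_ball_fin_num _)) [X in X%:E]splitr
   EFinD lteD.
Qed.

Lemma subadditive_bounded : exists2 C : R, 0 <= C &
  forall r g, 0 <= r -> word_ball S r g -> (L g <= (C * r + C)%:E)%E.
Proof.
have [C C1] := subadditive_bounded_generators.
exists C%:R => // r g r0 /word_ballP[w gw wr].
apply: (@le_trans _ _ (C%:R * (size w)%:R + C%:R)%:E); last first.
  by rewrite lee_fin lerD2r ler_wpM2l.
elim: w g gw {wr} => [|s w IH] g [Sw ->].
  by rewrite big_nil mulr0 add0r; apply: C1; exact: word_ball1.
rewrite big_cons; apply: (le_trans (LM _ _)).
have -> : C%:R * (size (s :: w))%:R + C%:R = C%:R + (C%:R * (size w)%:R + C%:R) :> R.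
  by rewrite /= -addn1 natrD; ring.
rewrite EFinD; apply: leeD.
  apply: C1; have [Ss|Ss] := Sw s (mem_head _ _); first exact: word_ball_gen.
  by rewrite -[s]invgK; apply: word_ballV; exact: word_ball_gen.
by apply: IH; split => // t tw; apply: Sw; rewrite inE tw orbT.
Qed.

End subadditive.
End ball.
End haar.

(** * Domination of growth functions *)

Lemma growth_le_trans (R : realType) (f g h : R -> R) :
  (forall t, 0 <= h t) -> {homo h : s t / s <= t} ->
  growth_le f g -> growth_le g h -> growth_le f h.
Proof.
move=> h0 hh [C C1 fg] [D D1 gh]; exists (C * D + C) => [|t t0]; first by nra.
apply: (le_trans (fg t t0)); rewrite [leRHS]addrA -/(_ + _).
have Ct0 : 0 <= C * t by nra.
have gCt := gh _ Ct0.
have hCt : h (D * (C * t)) <= h ((C * D + C) * t) by apply: hh; nra.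
have := h0 (D * (C * t)); have := h0 ((C * D + C) * t).
move: gCt hCt; set a := h _; set b := h _; set c := g _ => ? ? ? ?.
have ? : C * c <= C * (D * a + D) by apply: ler_wpM2l => //; lra.
have ? : C * D * a <= C * D * b by apply: ler_wpM2l => //; nra.
have ? : 0 <= C * b by nra.
lra.
Qed.

(** Small times, where the additive constant [b] cannot be absorbed by the
    dilation, are handled by the additive constant of [growth_le]. *)
Lemma growth_le_affine (R : realType) (f h : R -> R) (D a b : R) :
  0 <= D -> 0 <= a -> 0 <= b ->
  (forall t, 0 <= h t) -> {homo h : s t / s <= t} ->
  (forall t, 0 <= t -> f t <= D * h (a * t + b)) -> growth_le f h.
Proof.
move=> D0 a0 b0 h0 hh fh; have K0 : 0 <= D * h (a + b) by rewrite mulr_ge0.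
pose E := D + a + b + 1 + D * h (a + b).
have E0 : 0 <= E by rewrite /E; lra.
exists E => [|t t0]; first by rewrite /E; lra.
apply: (le_trans (fh t t0)); have [t1|t1] := leP t 1.
  apply: (@le_trans _ _ E); last by rewrite lerDr mulr_ge0.
  apply: (@le_trans _ _ (D * h (a + b))); last by rewrite /E; lra.
  by apply: ler_wpM2l => //; apply: hh; nra.
apply: (@le_trans _ _ (E * h (E * t))); last by rewrite lerDl.
apply: ler_pM => //; first by rewrite /E; lra.
by apply: hh; rewrite /E; nra.
Qed.

(** * Double counting *)

(** Tonelli's theorem is stated for bundled sigma-finite measures, whereas the
    measures of a coupling are bundled as mere measures; this lemma changes the
    bundle without changing the measure. *)
Lemma sigma_finite_measureP d (T : measurableType d) (R : realType)
    (mu : {measure set T -> \bar R}) : sigma_finite setT mu ->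
  exists nu : {sigma_finite_measure set T -> \bar R},
    mu = nu :> {measure set T -> \bar R}.
Proof.
move: mu => [f c] /= sf.
have sfin := sfinite_measure_sigma_finite (mu := Measure.Pack c) sf.
pose s1 := isSFinite.Build d T R f sfin.
pose s2 := isSigmaFinite.Build d T R f sf.
pose nu : {sigma_finite_measure set T -> \bar R} := HB.pack f c s1 s2.
by exists nu; rewrite /nu; case: c sfin sf @s1 @s2 @nu => c1 c2.
Qed.

Section double_counting.
Context d1 d2 (T1 : measurableType d1) (T2 : measurableType d2) (R : realType).
Context (m1 : {sigma_finite_measure set T1 -> \bar R}).
Context (m2 : {measure set T2 -> \bar R}) (sf2 : sigma_finite setT m2).
Local Open Scope ereal_scope.

Lemma measurable_fun_integral (f : T1 * T2 -> \bar R) :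
  measurable_fun setT f -> (forall p, 0 <= f p) ->
  measurable_fun setT (fun x => \int[m2]_y f (x, y)).
Proof.
have [nu ->] := sigma_finite_measureP sf2 => mf f0.
exact: measurable_fun_fubini_tonelli_F.
Qed.

(** Both sides bound the measure of [Z], computed by slices in one direction and
    in the other. *)
Lemma double_counting (Z : set (T1 * T2)) (A : set T1) (c : \bar R)
    (F : T2 -> \bar R) :
  measurable Z -> measurable A -> 0 <= c -> measurable_fun setT F ->
  (forall x, A x -> c <= m2 (xsection Z x)) ->
  (forall y, m1 (ysection Z y) <= F y) ->
  c * m1 A <= \int[m2]_y F y.
Proof.
have [nu ->] := sigma_finite_measureP sf2 => mZ mA c0 mF cZ ZF.
have F0 y : 0 <= F y by apply: le_trans (ZF y).
apply: (@le_trans _ _ (\int[nu]_y m1 (ysection Z y))); last first.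
  apply: ge0_le_integral => //; exact: measurable_fun_ysection.
have := indic_fubini_tonelli m1 nu mZ.
rewrite (indic_fubini_tonelli_FE nu mZ) (indic_fubini_tonelli_GE m1 mZ) => <-.
have mZx := measurable_fun_xsection nu mZ.
apply: (@le_trans _ _ (\int[m1]_(x in A) (nu (xsection Z x)))); last first.
  by apply: ge0_subset_integral.
rewrite -integral_cst//; apply: ge0_le_integral => //.
exact: measurable_funTS.
Qed.

End double_counting.

(** * Independence of the Haar measure and of the generating set *)

Section change_of_metric.
Context (R : realType) (G : topologicalGroupType) (polG : polish R G).

(** The pairs [(a, k)] with [a] in [A] and [a^-1 * k] in the ball [U] are counted
    twice: each [a] contributes [lam' U], and each [k], which has to lie in [W],
    at most [lam U], because [U] is symmetric. *)
Lemma haar_compare (lam lam' : {measure set (borel G) -> \bar R})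
    (S S' : set G) (r : R) (A : set (borel G)) (W : set (borel G)) :
  haar_measure lam -> haar_measure lam' ->
  compact_generating_set S' ->
  measurable A -> measurable W ->
  (forall a u, A a -> word_ball S' r u -> W (a * u)%g) ->
  (lam' (word_ball S' r) * lam A <= lam (word_ball S' r) * lam' W)%E.
Proof.
move=> hl hl' gS' mA mW AUW; set U : set (borel G) := word_ball S' r.
have mU : measurable U by exact: word_ball_measurable.
have [nu E] := sigma_finite_measureP (haar_sigma_finite polG hl gS').
have [nu' E'] := sigma_finite_measureP (haar_sigma_finite polG hl' gS').
rewrite {}E in hl *; rewrite {}E' in hl' *.
pose q (p : borel G * borel G) : borel G := ((p.1 : G)^-1 * (p.2 : G))%g.
have mq : measurable_fun setT q.
  exact: (measurable_mulg polG (measurable_invg measurable_fst) measurable_snd).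
pose Z := (A `*` setT) `&` q @^-1` U.
have mZ : measurable Z.
  by apply: measurableI; [exact: measurableX|exact: measurable_preimageT].
have := @double_counting _ _ _ _ R nu nu' (sigma_finiteT nu') Z A (nu' U)
  (fun k => (nu U * (\1_W k)%:E)%E) mZ mA (measure_ge0 _ _).
rewrite ge0_integralZl//; last by apply/measurable_EFinP.
rewrite integral_indic// setIT; apply.
- by apply: measurable_funeM; exact/measurable_EFinP.
- move=> a Aa; rewrite (_ : xsection Z a = [set k | U (a^-1 * k)%g]).
    by rewrite haar_mull.
  apply/seteqP; split=> k; rewrite /xsection/= inE /Z/q/=.
    by case.
  by [].
- move=> k; have [kW|kW] := pselect (W k); last first.
    rewrite (_ : ysection Z k = set0) ?measure0 ?mule_ge0//.
    apply/seteqP; split=> // a; rewrite /ysection/= inE /Z/q/= => -[[Aa _] Uak].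
    by apply: kW; rewrite -[k](mulVKg a); exact: AUW.
  rewrite indicE mem_set// mule1.
  rewrite -[leRHS](haar_mull hl k^-1%g mU); apply: le_measure; rewrite ?inE.
  + exact: measurable_ysection.
  + exact: measurable_preimageT (measurable_mull polG k^-1%g) mU.
  + move=> a; rewrite /ysection/= inE /Z/q/= => -[_ /word_ballV].
    by rewrite invgM invgK.
Qed.

(** The word length of [S'] is a subadditive function, hence affinely bounded by
    that of [S]; [haar_compare] does the rest. *)
Lemma volume_growth_change (lam lam' : {measure set (borel G) -> \bar R})
    (S S' : set G) :
  haar_measure lam -> haar_measure lam' ->
  compact_generating_set S -> compact_generating_set S' ->
  growth_le (volume_growth lam S) (volume_growth lam' S').
Proof.
move=> hl hl' gS gS'.
have [C C0 SC] := subadditive_bounded polG hl gS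
  (word_length_measurable polG gS' (@measurable_id _ (borel G) setT))
  (word_length_ge0 R S') (word_length_lty R gS') (word_lengthM R gS').
have [n n0] := haar_word_ball_gt0 polG hl' gS'.
pose V := volume_growth lam S'; pose V' := volume_growth lam' S'.
have V'n : 0 < V' n%:R.
  by rewrite /V' /volume_growth fine_gt0// n0 haar_word_ball_lty.
have cmp t : 0 <= t ->
    V' n%:R * volume_growth lam S t <= V n%:R * V' (C * t + C + n%:R).
  move=> t0; rewrite -lee_fin !EFinM -!volume_growthE//.
  apply: haar_compare => //; try exact: word_ball_measurable.
  by move=> a u at_ un; apply: word_ballM => //; exact: SC.
pose D := V n%:R / V' n%:R.
have D0 : 0 <= D by rewrite divr_ge0// ?volume_growth_ge0// ltW.
have cmp' t : 0 <= t -> volume_growth lam S t <= D * V' (C * t + C + n%:R).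
  by move=> t0; rewrite /D mulrAC ler_pdivlMr// mulrC cmp.
apply: (growth_le_affine D0 C0 (b := C + n%:R)) => //.
- by rewrite addr_ge0.
- exact: volume_growth_ge0.
- exact: le_volume_growth.
- by move=> t t0; rewrite addrA; exact: cmp'.
Qed.

End change_of_metric.

(** * Measure-preserving maps and product measures *)

Section ae.
Context d1 d2 (T1 : measurableType d1) (T2 : measurableType d2) (R : realType).
Context (m1 : {measure set T1 -> \bar R}) (m2 : {measure set T2 -> \bar R}).
Local Open Scope ereal_scope.

Lemma ae_comp (f : T1 -> T2) (P : T2 -> Prop) : measurable_fun setT f ->
  (forall N, measurable N -> m2 N = 0 -> m1 (f @^-1` N) = 0) ->
  {ae m2, forall y, P y} -> {ae m1, forall x, P (f x)}.
Proof.
move=> mf f0 [N [mN N0 PN]]; exists (f @^-1` N); split.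
- exact: measurable_preimageT.
- exact: f0.
- by move=> x /= nP; exact: PN.
Qed.

Lemma ae_le_measure (A B : set T1) : measurable A -> measurable B ->
  {ae m1, forall x, A x -> B x} -> m1 A <= m1 B.
Proof.
move=> mA mB [N [mN N0 ABN]]; apply: (@le_trans _ _ (m1 (B `|` N))).
  apply: le_measure; rewrite ?inE//; first exact: measurableU.
  move=> x Ax; have [Bx|nBx] := pselect (B x); [by left|right].
  by apply: ABN => /= /(_ Ax).
by rewrite (le_trans (measureU2 _ _ _))// [X in _ + X]N0 adde0.
Qed.

End ae.

Lemma ge0_integral_preserving d (T : measurableType d) (R : realType)
    (m : {measure set T -> \bar R}) (f : T -> T) (g : T -> \bar R) :
  measurable_fun setT f ->
  (forall B, measurable B -> m (f @^-1` B) = m B) ->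
  measurable_fun setT g -> (forall x, 0 <= g x)%E ->
  (\int[m]_x g (f x) = \int[m]_x g x)%E.
Proof.
move=> mf fm mg g0.
rewrite -(@ge0_integral_pushforward _ _ _ _ _ f mf m setT g) //.
apply: eq_measure_integral => A mA _; exact: fm.
Qed.

Section product.
Context d1 d2 (T1 : measurableType d1) (T2 : measurableType d2) (R : realType).
Context (m1 : {sigma_finite_measure set T1 -> \bar R}).
Context (m2 : {sigma_finite_measure set T2 -> \bar R}).
Local Open Scope ereal_scope.

Lemma product_measure_ysection (A : set (T1 * T2)) : measurable A ->
  (m1 \x m2) A = \int[m2]_y m1 (ysection A y).
Proof.
move=> mA; have := indic_fubini_tonelli m1 m2 mA.
by rewrite (indic_fubini_tonelli_FE m2 mA) (indic_fubini_tonelli_GE m1 mA).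
Qed.

Lemma product_sigma_finite (m3 : {finite_measure set T2 -> \bar R}) :
  sigma_finite setT (m1 \x m3).
Proof.
have [F FT Foo] := sigma_finiteT m1.
exists (fun n => F n `*` setT); first by rewrite -setX_bigcupl -FT setXTT.
move=> n; have [mF Fn] := Foo n; split; first exact: measurableX.
by rewrite product_measure1E// lte_mul_pinfty ?ge0_fin_numE// -ge0_fin_numE// fin_num_measure.
Qed.

(** Slice by slice: the slice of the preimage above [y] is the preimage under
    [theta y] of the slice of [N] above [T y]. *)
Lemma skew_product_preserving (theta : T2 -> T1 -> T1) (T : T2 -> T2) :
  measurable_fun setT (fun p : T1 * T2 => (theta p.2 p.1, T p.2)) ->
  measurable_fun setT T ->
  (forall y A, measurable A -> m1 (theta y @^-1` A) = m1 A) ->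
  (forall B, measurable B -> m2 (T @^-1` B) = m2 B) ->
  forall N, measurable N ->
  (m1 \x m2) ((fun p => (theta p.2 p.1, T p.2)) @^-1` N) = (m1 \x m2) N.
Proof.
move=> mphi mT th1 T2m N mN; rewrite !product_measure_ysection//; last first.
  exact: measurable_preimageT.
rewrite -(ge0_integral_preserving mT T2m (measurable_fun_ysection m1 mN))//.
apply: eq_integral => y _; transitivity (m1 (theta y @^-1` ysection N (T y))).
  by congr (m1 _); apply/seteqP; split => x; rewrite /ysection/= !inE.
by apply: th1; exact: measurable_ysection.
Qed.

Lemma cylinder_integral (U : set T1) (f : T2 -> \bar R) :
  measurable U -> measurable_fun setT f -> (forall y, 0 <= f y) ->
  \int[m1 \x m2]_p ((\1_U p.1)%:E * f p.2) = m1 U * \int[m2]_y f y.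
Proof.
move=> mU mf f0.
have mF : measurable_fun setT (fun p : T1 * T2 => (\1_U p.1)%:E * f p.2).
  apply: emeasurable_funM; last exact: measurableT_comp.
  by apply/measurable_EFinP; apply: measurableT_comp.
rewrite fubini_tonelli1//; last by move=> p; rewrite mule_ge0// lee_fin.
rewrite /fubini_F /=.
under eq_integral => x _ do rewrite ge0_integralZl//.
rewrite ge0_integralZr//; last by exact: integral_ge0.
  by rewrite integral_indic// setIT.
exact/measurable_EFinP.
Qed.

End product.

Section iso.
Context d1 d2 (T1 : measurableType d1) (T2 : measurableType d2) (R : realType).
Context (m1 : {measure set T1 -> \bar R}) (m2 : {measure set T2 -> \bar R}).
Context (f : T1 -> T2) (f' : T2 -> T1).
Hypothesis iso : measure_space_iso m1 m2 f f'.

Lemma iso_ae (P : T2 -> Prop) :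
  {ae m2, forall y, P y} -> {ae m1, forall x, P (f x)}.
Proof.
by have [mf _ _ _ f12] := iso; apply: ae_comp => // N mN N0; rewrite f12.
Qed.

Lemma iso_inv_ae (P : T1 -> Prop) :
  {ae m1, forall x, P x} -> {ae m2, forall y, P (f' y)}.
Proof.
have [mf mf' f'f _ f12] := iso; apply: ae_comp => // N mN N0.
have mfN : measurable (f' @^-1` N) by exact: measurable_preimageT.
rewrite -f12//; apply/eqP; rewrite -measure_le0 -N0.
apply: ae_le_measure => //; first exact: measurable_preimageT.
by apply: filterS f'f => x /= ->.
Qed.

End iso.

(** * Growth of coupled groups *)

Section coupling.
Context (R : realType) (G H : topologicalGroupType).
Context (polG : polish R G) (polH : polish R H).
Context (lamG : {sigma_finite_measure set (borel G) -> \bar R}).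
Context (lamH : {sigma_finite_measure set (borel H) -> \bar R}).
Context (haarG : haar_measure lamG) (haarH : haar_measure lamH).
Context (uG : unimodular R G) (uH : unimodular R H).
Context dO dG dH (Om : measurableType dO) (XG : measurableType dG)
  (XH : measurableType dH).
Context (mu : {measure set Om -> \bar R})
  (muG : {finite_measure set XG -> \bar R})
  (muH : {finite_measure set XH -> \bar R}).
Context (i : borel G * XG -> Om) (i' : Om -> borel G * XG).
Context (j : borel H * XH -> Om) (j' : Om -> borel H * XH).
Context (alpha : G -> XH -> borel H) (T : G -> XH -> XH).
Context (SG : set G) (SH : set H).
Context (genG : compact_generating_set SG) (genH : compact_generating_set SH).

Let mG : {measure set (borel G * XG) -> \bar R} := (lamG \x muG)%E.
Let mH : {measure set (borel H * XH) -> \bar R} := (lamH \x muH)%E.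
Let a : G -> Om -> Om := @translation G XG Om i i'.

Hypothesis i_iso : measure_space_iso mG mu i i'.
Hypothesis j_iso : measure_space_iso mH mu j j'.
Hypothesis a_cocycle : induced_cocycle lamH muH a j alpha T.
Hypothesis alpha_L1 :
  forall g, (\int[muH]_x word_length R SH (alpha g x) < +oo)%E.

Let left_translate (g : G) (p : borel G * XG) : borel G * XG :=
  ((g * (p.1 : G))%g : borel G, p.2).

Let left_translateE g w : a g w = i (left_translate g (i' w)).
Proof. by []. Qed.

Let measurable_left_translate g : measurable_fun setT (left_translate g).
Proof.
apply: measurable_fun_pair; last exact: measurable_snd.
exact: (measurableT_comp (measurable_mull polG g) measurable_fst).
Qed.

Let left_translate_preserving g N : measurable N ->
  mG (left_translate g @^-1` N) = mG N.
Proof.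
move=> mN; apply: (@skew_product_preserving _ _ _ _ _ lamG muG
  (fun _ h => (g * (h : G))%g : borel G) id) => //.
- exact: measurable_left_translate.
- by move=> _ A mA; exact: haar_mull.
Qed.

(** [translation] passes through the almost inverse [i'], so it is an action
    only almost everywhere. *)
Let a_mul g g' : {ae mu, forall w, a (g * g')%g w = a g (a g' w)}.
Proof.
have [_ _ i'i _ _] := i_iso.
have : {ae mG, forall p, i' (i (left_translate g' p)) = left_translate g' p}.
  apply: (ae_comp (measurable_left_translate g') _ i'i) => N mN N0.
  by rewrite left_translate_preserving.
move=> /(iso_inv_ae i_iso); apply: filterS => w E.
rewrite !left_translateE E /left_translate/=.
by rewrite mulgA.
Qed.

(** The action of [g] read in the coordinates [H * XH]. *)
Let phi (g : G) (p : borel H * XH) : borel H * XH :=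
  (((p.1 : H) * (alpha g p.2 : H)^-1)%g : borel H, T g p.2).

Let measurable_alpha g : measurable_fun setT (alpha g).
Proof. by have [] := a_cocycle g. Qed.

Let measurable_T g : measurable_fun setT (T g).
Proof. by have [] := a_cocycle g. Qed.

Let T_preserving g B : measurable B -> muH (T g @^-1` B) = muH B.
Proof. by have [_ _ + _] := a_cocycle g; apply. Qed.

Let measurable_phi g : measurable_fun setT (phi g).
Proof.
have ma := measurableT_comp (measurable_alpha g)
  (@measurable_snd _ _ (borel H) XH).
apply: measurable_fun_pair; last exact: measurableT_comp measurable_snd.
exact: (measurable_mulg polH measurable_fst (measurable_invg ma)).
Qed.

(** This is where unimodularity of [H] enters: [phi g] multiplies the
    [H]-coordinate on the right. *)
Let phi_preserving g N : measurable N -> mH (phi g @^-1` N) = mH N.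
Proof.
move=> mN; apply: (@skew_product_preserving _ _ _ _ _ lamH muH
  (fun x h => ((h : H) * (alpha g x : H)^-1)%g : borel H) (T g)) => //.
- exact: measurable_phi.
- by move=> x A mA; exact: (haar_mulr haarH uH).
- exact: T_preserving.
Qed.

Let ae_phi g P : {ae mH, forall p, P p} -> {ae mH, forall p, P (phi g p)}.
Proof. by apply: ae_comp => // N mN N0; rewrite phi_preserving. Qed.

Let action_coord g : {ae mH, forall p, j' (a g (j p)) = phi g p}.
Proof.
have [_ _ /(ae_phi g) j'j _ _] := j_iso.
have [_ _ _] := a_cocycle g.
by move: j'j; apply: filterS2 => p E1 ->.
Qed.

Let phi_mul g g' : {ae mH, forall p, phi (g * g')%g p = phi g (phi g' p)}.
Proof.
have A1 := iso_ae j_iso (a_mul g g').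
have [_ _ _ A2] := a_cocycle g'.
have A3 := ae_phi g' (action_coord g).
apply: filterS3 (filterI A1 (action_coord (g * g')%g)) A2 A3 => p [E1 E2] E3 E4.
by rewrite -E2 E1 E3.
Qed.

(** Compare the [H]-coordinates in [phi_mul] and cancel the common left
    factor. *)
Let alpha_mul g g' : {ae mH, forall p, alpha (g * g')%g p.2 =
  ((alpha g (T g' p.2) : H) * (alpha g' p.2 : H))%g :> H}.
Proof.
apply: filterS (phi_mul g g') => p [/= E _].
by move: E; rewrite -mulgA -invgM => /mulgI/invg_inj.
Qed.

Let len (h : borel H) : \bar R := word_length R SH h.

Let measurable_len d (X : measurableType d) (f : X -> borel H) :
  measurable_fun setT f -> measurable_fun setT (fun x => len (f x)).
Proof. exact: word_length_measurable. Qed.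

Section displacement.
Context (r : R).
Let U : set (borel H) := word_ball SH r.

Let mU : measurable U. Proof. exact: word_ball_measurable. Qed.

(** Up to the factor [lamH U] this is the mean length of [alpha g]
    ([displacementE]); integrating over the product with a ball makes it
    expressible by the action on [Omega] alone. *)
Definition displacement (g : G) : \bar R :=
  (\int[mH]_p ((\1_U p.1)%:E * len (alpha g p.2)))%E.

Lemma displacementE g :
  displacement g = (lamH U * \int[muH]_x len (alpha g x))%E.
Proof.
apply: (@cylinder_integral _ _ _ _ _ lamH muH U (fun x => len (alpha g x))) => //.
  exact: measurable_len.
by move=> x; exact: word_length_ge0.
Qed.

Lemma displacement_ge0 g : (0 <= displacement g)%E.
Proof.
apply: integral_ge0 => p _; apply: mule_ge0; first by rewrite lee_fin.
exact: word_length_ge0.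
Qed.

Lemma displacement_lty g : (displacement g < +oo)%E.
Proof.
rewrite displacementE; apply: lte_mul_pinfty => //.
exact: haar_word_ball_fin_num.
Qed.

Lemma measurable_cylinder (f : XH -> borel H) : measurable_fun setT f ->
  measurable_fun setT
    (fun p : borel H * XH => ((\1_U p.1)%:E * len (f p.2))%E).
Proof.
move=> mf; apply: emeasurable_funM.
  by apply/measurable_EFinP; exact: (measurableT_comp (measurable_indic mU)).
by apply: measurable_len; exact: (measurableT_comp mf).
Qed.

(** Apply the cocycle identity and use that [T g'] preserves [muH]. *)
Lemma displacementM g g' :
  (displacement (g * g')%g <= displacement g + displacement g')%E.
Proof.
have -> : displacement g =
    (\int[mH]_p ((\1_U p.1)%:E * len (alpha g (T g' p.2))))%E.
  rewrite displacementE -(ge0_integral_preserving (measurable_T g') (T_preserving g'))//.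
  - apply/esym.
    apply: (@cylinder_integral _ _ _ _ _ lamH muH U (fun x => len (alpha g (T g' x)))) => //.
      by apply: measurable_len; exact: measurableT_comp.
    by move=> x; exact: word_length_ge0.
  - exact: measurable_len.
  - by move=> x; exact: word_length_ge0.
have len0 p (f : XH -> borel H) :
    (0 <= (\1_U p.1)%:E * len (f p.2) :> \bar R)%E.
  by rewrite mule_ge0 ?lee_fin//; exact: word_length_ge0.
have maT : measurable_fun setT (fun x => alpha g (T g' x)).
  exact: measurableT_comp.
rewrite -ge0_integralD//; last 3 first.
- by move=> p _; exact: (len0 p (fun x => alpha g (T g' x))).
- exact: (measurable_cylinder maT).
- exact: (measurable_cylinder (measurable_alpha g')).
apply: ae_ge0_le_integral; first exact: measurableT.
- by move=> p _; exact: (len0 p (alpha (g * g')%g)).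
- exact: (measurable_cylinder (measurable_alpha (g * g')%g)).
- move=> p _; apply: adde_ge0; first exact: (len0 p (fun x => alpha g (T g' x))).
  exact: (len0 p (alpha g')).
- exact: (emeasurable_funD (measurable_cylinder maT)
    (measurable_cylinder (measurable_alpha g'))).
- apply: filterS (alpha_mul g g') => p E _.
  rewrite -ge0_muleDr; try exact: word_length_ge0.
  apply: lee_wpmul2l; first by rewrite lee_fin.
  by rewrite E; exact: word_lengthM.
Qed.

(** The cocycle is only measurable in [x] for each [g], not jointly in [g] and
    [x].  But the length of [alpha g x] is almost everywhere the length of
    [(h * (alpha g x)^-1)^-1 * h], which compares the [H]-coordinates of
    [j (h, x)] and of its translate by [g]; this expression is jointly
    measurable, and Tonelli's theorem applies. *)
Lemma measurable_displacement :
  measurable_fun setT (displacement : borel G -> \bar R).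
Proof.
pose q (z : borel G * (borel H * XH)) : borel G * XG :=
  (((z.1 : G) * ((i' (j z.2)).1 : G))%g : borel G, (i' (j z.2)).2).
have [mi mi' _ _ _] := i_iso; have [mj mj' _ _ _] := j_iso.
have mi'j : measurable_fun setT
    (fun z : borel G * (borel H * XH) => i' (j z.2)).
  exact: (measurableT_comp mi' (measurableT_comp mj measurable_snd)).
have mq : measurable_fun setT q.
  apply: measurable_fun_pair; last exact: measurableT_comp measurable_snd mi'j.
  exact: (measurable_mulg polG measurable_fst
    (measurableT_comp measurable_fst mi'j)).
pose s z : borel H := (((j' (i (q z))).1 : H)^-1 * (z.2.1 : H))%g.
have ms : measurable_fun setT s.
  apply: (measurable_mulg polH (measurable_invg _)).
    exact: (measurableT_comp measurable_fst
      (measurableT_comp mj' (measurableT_comp mi mq))).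
  exact: (measurableT_comp measurable_fst measurable_snd).
pose f z : \bar R := ((\1_U z.2.1)%:E * len (s z))%E.
have mf : measurable_fun setT f.
  apply: emeasurable_funM; last exact: measurable_len.
  apply/measurable_EFinP; apply: (measurableT_comp (measurable_indic mU)).
  exact: (measurableT_comp measurable_fst measurable_snd).
have f0 z : (0 <= f z)%E.
  by rewrite mule_ge0 ?lee_fin//; exact: word_length_ge0.
have := measurable_fun_integral (product_sigma_finite lamH muH) mf f0.
rewrite (_ : (fun _ => _) = displacement)//.
apply/funext => g.
apply: ae_eq_integral => //.
- exact: (measurableT_comp mf
    (@pair1_measurable _ _ (borel G) (borel H * XH)%type g)).
- exact: (measurable_cylinder (measurable_alpha g)).
- apply: filterS (action_coord g) => p E _.
  rewrite /f /s /= -[i (q (g, p))]/(a g (j p)) E /=.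
  by rewrite invgM invgK mulgVK.
Qed.

End displacement.
Hypothesis mu_neq0 : mu setT != 0%E.

Let hcoord (p : borel G * XG) : borel H := (j' (i p)).1.

Let measurable_hcoord : measurable_fun setT hcoord.
Proof.
have [mi _ _ _ _] := i_iso; have [_ mj' _ _ _] := j_iso.
exact: (measurableT_comp measurable_fst (measurableT_comp mj' mi)).
Qed.

Let hball (s : R) : set (borel G * XG) := [set p | word_ball SH s (hcoord p)].

Let gball (r : R) : set (borel G * XG) := [set p | word_ball SG r p.1].

Let measurable_hball s : measurable (hball s).
Proof.
apply: (measurable_preimageT measurable_hcoord).
exact: word_ball_measurable.
Qed.

Let measurable_gball r : measurable (gball r).
Proof.
apply: (measurable_preimageT measurable_fst).
exact: word_ball_measurable.
Qed.

(** The set [hball s] is the cylinder over a ball when read in [H * XH]. *)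
Let measure_hball s :
  mG (hball s) = (lamH (word_ball SH s) * muH setT)%E.
Proof.
have [mi mi' _ _ imu] := i_iso; have [mj mj' j'j _ jmu] := j_iso.
have mB : measurable (word_ball SH s : set (borel H)).
  exact: word_ball_measurable.
have mC : measurable [set w | word_ball SH s (j' w).1].
  exact: (measurable_preimageT (measurableT_comp measurable_fst mj') mB).
rewrite -(@product_measure1E _ _ _ _ R lamH muH _ _ mB measurableT).
rewrite (imu _ mC : mG (hball s) = _) -jmu//.
have mD : measurable (word_ball SH s `*` setT : set (borel H * XH)%type).
  exact: measurableX.
have mE : measurable (j @^-1` [set w | word_ball SH s (j' w).1]).
  exact: measurable_preimageT.
apply/eqP; rewrite eq_le; apply/andP; split; apply: ae_le_measure => //.
  by apply: filterS j'j => p /= -> ?; split.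
by apply: filterS j'j => p /= -> [].
Qed.

Let base_gt0 : exists r : nat, (0 < mG (gball r%:R `&` hball r%:R))%E.
Proof.
apply: (measure_bigcup_gt0 (F := fun n : nat => gball n%:R `&` hball n%:R)).
  by move=> n; exact: measurableI.
rewrite (_ : \bigcup_n _ = i @^-1` setT); first by have [_ _ _ _ ->] := i_iso.
apply/seteqP; split=> // p _.
have [m pm] := word_ball_cover R genG p.1.
have [n pn] := word_ball_cover R genH (hcoord p).
exists (maxn m n) => //; split.
  by apply: le_word_ball pm; rewrite ler_nat leq_maxl.
by apply: le_word_ball pn; rewrite ler_nat leq_maxr.
Qed.

Let escape (r s : R) (g : G) : set (borel G * XG) :=
  hball r `\` left_translate g @^-1` hball (r + s).

Let measurable_escape r s g : measurable (escape r s g).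
Proof. by apply: measurableD => //; exact: measurable_preimageT. Qed.

(** Read in [H * XH], an escaping point [(h, x)] has [|alpha g x| > s], so this
    is Markov's inequality. *)
Let escape_le r s g : 0 <= s ->
  (s%:E * mG (escape r s g) <= displacement r g)%E.
Proof.
move=> s0.
have [mi mi' i'i _ imu] := i_iso; have [mj mj' j'j _ jmu] := j_iso.
have ma : measurable_fun setT (a g).
  exact: (measurableT_comp mi
    (measurableT_comp (measurable_left_translate g) mi')).
have mBr : measurable (word_ball SH r : set (borel H)).
  exact: word_ball_measurable.
have mBrs : measurable (word_ball SH (r + s) : set (borel H)).
  exact: word_ball_measurable.
pose W := [set w | word_ball SH r (j' w).1] `\`
          [set w | word_ball SH (r + s) (j' (a g w)).1].
have mW : measurable W.
  apply: measurableD.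
    exact: (measurable_preimageT (measurableT_comp measurable_fst mj') mBr).
  exact: (measurable_preimageT (measurableT_comp measurable_fst
    (measurableT_comp mj' ma)) mBrs).
pose V := [set p : borel H * XH |
  word_ball SH r p.1 /\ (s%:E < len (alpha g p.2))%E].
have mV : measurable V.
  apply: measurableI.
    exact: (measurable_preimageT measurable_fst mBr).
  rewrite -[X in measurable X]setTI; apply: emeasurable_fun_o_infty => //.
  by apply: measurable_len; exact: (measurableT_comp (measurable_alpha g)).
have EV : (mG (escape r s g) <= mH V)%E.
  apply: (@le_trans _ _ (mG (i @^-1` W))).
    apply: ae_le_measure => //; first exact: measurable_preimageT.
    apply: filterS i'i => p E [pr /= nps]; split=> //=.
    by rewrite left_translateE E.
  rewrite imu// -jmu//; apply: ae_le_measure => //.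
    exact: measurable_preimageT.
  apply: filterS2 j'j (action_coord g) => p E1 E2; rewrite /W/= E1 E2 => -[pr npr].
  split => //; rewrite ltNge; apply/negP => ls; apply: npr.
  by apply: word_ballM => //; exact: word_ballV.
apply: (@le_trans _ _ (s%:E * mH V)%E); first by apply: lee_wpmul2l.
rewrite -(setIT V) -integral_indic//.
rewrite -ge0_integralZl//; last by apply/measurable_EFinP.
have mU : measurable (word_ball SH r : set (borel H)) by [].
apply: ge0_le_integral => //.
- by move=> p _; apply: mule_ge0; rewrite lee_fin.
- by apply: measurable_funeM; exact/measurable_EFinP.
- exact: measurable_cylinder.
move=> p _; have [[pr ps]|nV] := pselect (V p); last first.
  rewrite indicE memNset// mule0 mule_ge0 ?lee_fin//; exact: word_length_ge0.
by rewrite !indicE !mem_set// mul1e mule1; exact: ltW.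
Qed.

Let mG_hball_lty s : (mG (hball s) < +oo)%E.
Proof.
rewrite measure_hball; apply: lte_mul_pinfty => //.
  exact: haar_word_ball_fin_num.
by rewrite -ge0_fin_numE// fin_num_measure.
Qed.

(** Double counting of the pairs [(g, (k, y))] such that [(k, y)] has both
    coordinates in balls of radius [r] and [(g * k, y)] has [H]-coordinate in
    the ball of radius [s]. *)
Let ball_mul_le (r s t : R) (c : \bar R) : (0 <= c)%E ->
  (forall g, word_ball SG t g ->
    c <= mG ((gball r `&` hball r) `&` left_translate g @^-1` hball s))%E ->
  (c * lamG (word_ball SG t) <=
   lamG (word_ball SG r) * (lamH (word_ball SH s) * muH setT))%E.
Proof.
move=> c0 cle.
pose q (z : borel G * (borel G * XG)) := left_translate z.1 z.2.
have mq : measurable_fun setT q.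
  apply: measurable_fun_pair; last exact: measurableT_comp measurable_snd measurable_snd.
  exact: (measurable_mulg polG measurable_fst
    (measurableT_comp measurable_fst measurable_snd)).
pose Z := (setT `*` (gball r `&` hball r)) `&` q @^-1` hball s.
have mZ : measurable Z.
  apply: measurableI; last exact: measurable_preimageT.
  by apply: measurableX => //; exact: measurableI.
have mBt : measurable (word_ball SG t : set (borel G)).
  exact: word_ball_measurable.
have mBr : measurable (word_ball SG r : set (borel G)).
  exact: word_ball_measurable.
pose f y := lamG (ysection (hball s) y).
have mf : measurable_fun setT f by exact: measurable_fun_ysection.
rewrite -measure_hball [mG _](product_measure_ysection _ _ (measurable_hball s)).
rewrite -(cylinder_integral lamG muG mBr mf)//.
apply: (double_counting (product_sigma_finite lamG muG) mZ mBt c0).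
- apply: emeasurable_funM; last exact: measurableT_comp.
  by apply/measurable_EFinP; exact: (measurableT_comp (measurable_indic mBr)).
- move=> g gt; apply: (le_trans (cle g gt)); apply: le_measure; rewrite ?inE.
  + apply: measurableI; first exact: measurableI.
    exact: (measurable_preimageT (measurable_left_translate g)).
  + exact: measurable_xsection.
  + by move=> p [pr ps]; rewrite /xsection/= inE.
- move=> p; have [pr|npr] := pselect (word_ball SG r p.1); last first.
    rewrite (_ : ysection Z p = set0) ?measure0 ?mule_ge0// ?lee_fin//.
    by apply/seteqP; split=> // g; rewrite /ysection/= inE => -[[_ [/npr]]].
  rewrite indicE mem_set// mul1e.
  rewrite -[leRHS](haar_mulr haarG uG p.1); last exact: measurable_ysection.
  apply: le_measure; rewrite ?inE; first exact: measurable_ysection.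
    apply: (measurable_preimageT (measurable_mulr polG p.1)).
    exact: measurable_ysection.
  by move=> g; rewrite /ysection/= !inE => -[_].
Qed.

(** With [s] affine in [t], escaping points make up at most half of the fixed
    non-null set [A0], uniformly over the ball of radius [t]; then apply
    [ball_mul_le] with [c] half the measure of [A0]. *)
Lemma coupling_growth_le :
  growth_le (volume_growth lamG SG) (volume_growth lamH SH).
Proof.
have [n n0] := base_gt0; set r : R := n%:R in n0.
set A0 := _ `&` _ in n0.
have mA0 : measurable A0 by exact: measurableI.
have fA0 : mG A0 \is a fin_num.
  rewrite ge0_fin_numE//; apply: le_lt_trans (mG_hball_lty r).
  by apply: le_measure; rewrite ?inE//; exact: subIsetr.
have [C C0 dC] := subadditive_bounded polG haarG genG (measurable_displacement r)
  (displacement_ge0 r) (displacement_lty r) (displacementM r).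
set m0 := fine (mG A0).
have m0_gt0 : 0 < m0 by rewrite fine_gt0// n0 -ge0_fin_numE.
set M := fine (muH setT).
have M0 : 0 <= M by exact: fine_ge0.
pose VG := volume_growth lamG SG; pose VH := volume_growth lamH SH.
pose K := 2 / m0; have K0 : 0 <= K by rewrite divr_ge0// ltW.
have Km0 : K * m0 = 2 by rewrite /K mulfVK// gt_eqF.
apply: (growth_le_affine (D := K * VG r * M) (a := K * C)
  (b := K * (C + 1) + r)).
- by apply: mulr_ge0 => //; apply: mulr_ge0 => //; exact: volume_growth_ge0.
- by rewrite mulr_ge0.
- by apply: addr_ge0 => //; apply: mulr_ge0 => //; exact: addr_ge0.
- exact: volume_growth_ge0.
- exact: le_volume_growth.
(* Markov's bound [(C t + C) / s] is to be at most [m0 / 2]; the term [1] keeps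
   [s] positive when [C = 0]. *)
move=> t t0; pose s := K * (C * t + C + 1).
have s0 : 0 < s.
  by rewrite mulr_gt0 ?divr_gt0// ltr_wpDl// addr_ge0// mulr_ge0.
have -> : K * C * t + (K * (C + 1) + r) = r + s by rewrite /s; ring.
have esc g : word_ball SG t g -> (mG (escape r s g) <= (m0 / 2)%:E)%E.
  move=> gt.
  have fe : mG (escape r s g) \is a fin_num.
    rewrite ge0_fin_numE//; apply: le_lt_trans (mG_hball_lty r).
    by apply: le_measure; rewrite ?inE//; exact: subDsetl.
  have := le_trans (escape_le r g (ltW s0)) (dC t g t0 gt).
  rewrite -(fineK fe) -EFinM !lee_fin => se.
  rewrite -(ler_pM2l s0); apply: (le_trans se).
  have -> : s * (m0 / 2) = (C * t + C + 1) * (K * m0 / 2) by rewrite /s; ring.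
  by rewrite Km0 divff// mulr1 lerDl.
have half g : word_ball SG t g ->
    ((m0 / 2)%:E <= mG (A0 `&` left_translate g @^-1` hball (r + s)))%E.
  move=> gt; set D := _ `&` _.
  have mD : measurable D.
    by apply: measurableI => //; exact: measurable_preimageT.
  have : (mG A0 <= mG D + mG (escape r s g))%E.
    apply: (@le_trans _ _ (mG (D `|` escape r s g))); last exact: measureU2.
    apply: le_measure; rewrite ?inE//; first exact: measurableU.
    move=> p Ap; have [ps|nps] := pselect (hball (r + s) (left_translate g p)).
      by left.
    by right; split => //; exact: Ap.2.
  have fD : mG D \is a fin_num.
    rewrite ge0_fin_numE//; apply: le_lt_trans (mG_hball_lty r).
    apply: le_measure; rewrite ?inE// => p [[]]//.
  move=> /le_trans -/(_ _ (leeD2l _ (esc g gt))).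
  rewrite -(fineK fA0) -(fineK fD) -EFinD !lee_fin -/m0; lra.
have := ball_mul_le _ half; rewrite lee_fin divr_ge0 ?(ltW m0_gt0)// => /(_ isT).
rewrite !volume_growthE// -[muH setT]fineK ?fin_num_measure// -!EFinM lee_fin.
rewrite -/M => cnt.
have -> : K * VG r * M * VH (r + s) = K * (VG r * (VH (r + s) * M)) by ring.
apply: le_trans (ler_wpM2l K0 cnt).
have -> : K * (m0 / 2 * volume_growth lamG SG t) =
  K * m0 / 2 * volume_growth lamG SG t by ring.
by rewrite Km0 divff// mul1r.
Qed.

End coupling.

(** * Invariance of growth *)

Theorem theoremA2 (R : realType) (G H : topologicalGroupType)
  (polishG : polish R G) (polishH : polish R H)
  (lcG : locally_compact [set: G]) (lcH : locally_compact [set: H])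
  (cgG : exists S : set G, compact_generating_set S)
  (cgH : exists S : set H, compact_generating_set S)
  (unimodG : unimodular R G) (unimodH : unimodular R H)
  (GH : L1_measure_equivalent R G H)
  (lambdaG : {measure set (borel G) -> \bar R})
  (lambdaH : {measure set (borel H) -> \bar R})
  (haarG : haar_measure lambdaG) (haarH : haar_measure lambdaH)
  (SG : set G) (SH : set H)
  (genG : compact_generating_set SG) (genH : compact_generating_set SH) :
  growth_equiv (volume_growth lambdaG SG) (volume_growth lambdaH SH).
Proof.
have [nuG [nuH [UG [UH [hG hH gG gH [c ac]]]]]] := GH.
suff [GH' HG'] : growth_equiv (volume_growth nuG UG) (volume_growth nuH UH).
  split.
    apply: (growth_le_trans (g := volume_growth nuG UG)).
    - exact: volume_growth_ge0.
    - by move=> s t; exact: le_volume_growth.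
    - exact: (volume_growth_change polishG).
    apply: (growth_le_trans _ _ GH').
    - exact: volume_growth_ge0.
    - by move=> s t; exact: le_volume_growth.
    - exact: (volume_growth_change polishH).
  apply: (growth_le_trans (g := volume_growth nuH UH)).
  - exact: volume_growth_ge0.
  - by move=> s t; exact: le_volume_growth.
  - exact: (volume_growth_change polishH).
  apply: (growth_le_trans _ _ HG').
  - exact: volume_growth_ge0.
  - by move=> s t; exact: le_volume_growth.
  - exact: (volume_growth_change polishG).
have [mG EG] := sigma_finite_measureP (haar_sigma_finite polishG hG gG).
have [mH EH] := sigma_finite_measureP (haar_sigma_finite polishH hH gH).
subst nuG nuH; have [alpha [T [beta [S [aT bS aL bL]]]]] := ac.
by split; [apply: (coupling_growth_le polishG polishH hG hH unimodG unimodH gG gH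
    (cpl_iota_iso c) (cpl_j_iso c) aT aL (cpl_mu_neq0 c))
  |apply: (coupling_growth_le polishH polishG hH hG unimodH unimodG gH gG
    (cpl_j_iso c) (cpl_iota_iso c) bS bL (cpl_mu_neq0 c))].
Qed.
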